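(* Let $r$ and $n$ be positive integers and $m=rn+1$. Then the Möbius function $\mu(\hat0,\hat1)$ of the lattice $\Pi_m^{r,1}$ equals $0$.
   Context: For positive integers $r,j$, nonnegative $n$ and $m=rn+j$, $\Pi_m^{r,j}$ is the poset of all set partitions $\pi$ of $\{1,\dots,m\}$ such that the block containing $m$ has cardinality at least $j$ and every block not containing $m$ has cardinality divisible by $r$, ordered by refinement, together with a newly adjoined minimum $\hat0$; its maximum $\hat1$ is the one-block partition. (For $j=1$ the first condition is vacuous.) *)

(* Defs.v *)
From HB Require Import structures.
From mathcomp Require Import all_boot all_order all_algebra.
Set Implicit Arguments.
Unset Strict Implicit.
Unset Printing Implicit Defensive.
Import Order.TTheory GRing.Theory.
Local Open Scope order_scope.

Section Mobius.
Variables (d : Order.disp_t) (T : finPOrderType d).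
Implicit Types x y z : T.

(* The number k bounds the recursion depth; the recursive call on (x, z) has
   x <= z < y, so depth #|T| is always enough: see the characterization
   mobiusxx, mobius_lt, mobius_nle below. *)
Fixpoint mobius_rec (k : nat) x y : int :=
  if k is k'.+1 then
    if x == y then 1%R
    else if x < y then (- \sum_(z : T | (x <= z < y)%O) mobius_rec k' x z)%R
    else 0%R
  else 0%R.

Definition mobius x y : int := mobius_rec #|T| x y.

Lemma mobius_rec_nle k x y : ~~ (x <= y) -> mobius_rec k x y = 0%R.
Proof.
case: k => //= k nle; case: eqP nle => [->|_]; first by rewrite lexx.
by case: ifP => // /ltW ->.
Qed.

Lemma mobius_rec_stable k1 k2 x y :
    (#|[set z : T | (x <= z <= y)%O]| <= k1)%N ->
    (#|[set z : T | (x <= z <= y)%O]| <= k2)%N ->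
  mobius_rec k1 x y = mobius_rec k2 x y.
Proof.
have [lexy|nle] := boolP (x <= y); last by rewrite !mobius_rec_nle.
have gt0 z : x <= z -> (0 < #|[set t : T | (x <= t <= z)%O]|)%N.
  by move=> lexz; apply/card_gt0P; exists x; rewrite inE lexx.
elim: k1 k2 y lexy => [|k1 IH] k2 y lexy le1 le2.
  by have := gt0 y lexy; rewrite ltnNge le1.
case: k2 le2 => [|k2] le2; first by have := gt0 y lexy; rewrite ltnNge le2.
rewrite /=; case: eqP => // _; case: ifP => // ltxy; congr (- _)%R.
apply: eq_bigr => z /andP[lexz ltzy].
have lt : (#|[set t : T | (x <= t <= z)%O]| < #|[set t : T | (x <= t <= y)%O]|)%N.
  apply/proper_card/properP; split.
    apply/subsetP => t; rewrite !inE => /andP[-> letz].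
    exact: le_trans letz (ltW ltzy).
  by exists y; rewrite !inE ?lexx ?(ltW ltxy) //= (lt_geF ltzy).
by apply: IH => //; rewrite -ltnS; apply: leq_trans lt _.
Qed.

Lemma mobius_recE k x y : (#|T| <= k)%N -> mobius_rec k x y = mobius x y.
Proof.
by move=> le; apply: mobius_rec_stable; rewrite ?max_card // (leq_trans _ le) ?max_card.
Qed.

Lemma mobiusxx x : mobius x x = 1%R.
Proof. by rewrite -(mobius_recE x x (leqnSn _)) /= eqxx. Qed.

Lemma mobius_lt x y :
  x < y -> mobius x y = (- \sum_(z : T | (x <= z < y)%O) mobius x z)%R.
Proof. by move=> lt; rewrite -(mobius_recE x y (leqnSn _)) /= lt_eqF // lt. Qed.

Lemma mobius_nle x y : ~~ (x <= y) -> mobius x y = 0%R.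
Proof. exact: mobius_rec_nle. Qed.

End Mobius.

Definition with_bot (T : Type) : Type := option T.

HB.instance Definition _ (T : finType) := Finite.on (with_bot T).

Section WithBot.
Variables (d : Order.disp_t) (T : finTPOrderType d).
Implicit Types a b c : with_bot T.

Definition with_bot_le a b : bool :=
  match a, b with
  | None, _ => true
  | Some _, None => false
  | Some x, Some y => x <= y
  end.

Fact with_bot_le_refl : reflexive with_bot_le.
Proof. by case=> //= x; exact: lexx. Qed.

Fact with_bot_le_anti : antisymmetric with_bot_le.
Proof. by case=> [x|] [y|] //= /le_anti ->. Qed.

Fact with_bot_le_trans : transitive with_bot_le.
Proof. by case=> [y|] [x|] [z|] //=; exact: le_trans. Qed.

HB.instance Definition _ := Order.Le_isPOrder.Build d (with_bot T)
  with_bot_le_refl with_bot_le_anti with_bot_le_trans.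

Fact with_bot_le0 a : (None : with_bot T) <= a.
Proof. by []. Qed.

Fact with_bot_le1 a : a <= (Some \top : with_bot T).
Proof. by case: a => // x; exact: lex1. Qed.

HB.instance Definition _ := Order.hasBottom.Build d (with_bot T) with_bot_le0.
HB.instance Definition _ := Order.hasTop.Build d (with_bot T) with_bot_le1.

End WithBot.

Fact refinement_display : Order.disp_t. Proof. exact. Qed.

Section RJPartitions.
Variables r j n : nat.

(* i : 'I_m stands for the element i.+1 of {1, ..., m}. *)
Definition is_rj_partition (m : nat) (P : {set {set 'I_m}}) : bool :=
  partition P [set: 'I_m] &&
  [forall B in P, if [exists i in B, i.+1 == m] then (j <= #|B|)%N
                  else (r %| #|B|)%N].

Definition rj_partition : Type :=
  {P : {set {set 'I_(r * n + j)}} | is_rj_partition P}.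

HB.instance Definition _ := Finite.on rj_partition.

Implicit Types P Q : rj_partition.

Definition refines P Q : bool :=
  [forall A in val P, exists B in val Q, A \subset B].

Lemma refinesP P Q :
  reflect (forall A, A \in val P -> exists2 B, B \in val Q & A \subset B)
          (refines P Q).
Proof. by apply: (iffP forall_inP) => H A /H /exists_inP. Qed.

Fact rj_trivIset P : trivIset (val P).
Proof. by case: P => P /= /andP[/and3P[]]. Qed.

Fact rj_set0 P : set0 \notin val P.
Proof. by case: P => P /= /andP[/and3P[]]. Qed.

Fact refines_refl : reflexive refines.
Proof. by move=> P; apply/refinesP => A AP; exists A. Qed.

Fact refines_trans : transitive refines.
Proof.
move=> Q P S /refinesP PQ /refinesP QS; apply/refinesP => A /PQ[B BQ AB].
by have [C CS BC] := QS B BQ; exists C => //; exact: subset_trans BC.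
Qed.

Fact refines_sub P Q : refines P Q -> refines Q P -> val P \subset val Q.
Proof.
move=> /refinesP PQ /refinesP QP; apply/subsetP => A AP.
have [B BQ AB] := PQ A AP; have [C CP BC] := QP B BQ.
have [x xA] : exists x, x \in A.
  by apply/set0Pn; apply: contraNneq (rj_set0 P) => <-.
have xC : x \in C by exact: (subsetP BC) (subsetP AB x xA).
have AC : A = C.
  by rewrite -(def_pblock (rj_trivIset P) AP xA) (def_pblock (rj_trivIset P) CP xC).
by suff -> : A = B by []; apply/eqP; rewrite eqEsubset AB AC.
Qed.

Fact refines_anti : antisymmetric refines.
Proof.
move=> P Q /andP[PQ QP]; apply/val_inj/eqP.
by rewrite eqEsubset !refines_sub.
Qed.

HB.instance Definition _ := Order.Le_isPOrder.Build refinement_display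
  rj_partition refines_refl refines_anti refines_trans.

(* Removing set0 only matters when r * n + j = 0; see one_blockE. *)
Definition one_block_set (m : nat) : {set {set 'I_m}} :=
  [set [set: 'I_m]] :\ set0.

Fact one_block_subproof : is_rj_partition (one_block_set (r * n + j)).
Proof.
apply/andP; split.
  rewrite /partition /one_block_set !inE eqxx /= andbT; apply/andP; split.
    rewrite eqEsubset subsetT /=; apply/subsetP => x _.
    apply/bigcupP; exists [set: 'I_(r * n + j)]; rewrite !inE // eqxx andbT.
    by apply/set0Pn; exists x.
  apply/trivIsetP => A B; rewrite !inE => /andP[_ /eqP->] /andP[_ /eqP->].
  by rewrite eqxx.
apply/forall_inP => B; rewrite !inE => /andP[/set0Pn[x _] /eqP->].
case: ifP => [_|/existsP[]]; first by rewrite cardsT card_ord leq_addl.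
have m0 : (0 < r * n + j)%N by exact: leq_trans (ltn_ord x).
have lt : ((r * n + j).-1 < r * n + j)%N by rewrite prednK.
by exists (Ordinal lt); rewrite inE /= prednK.
Qed.

Definition one_block : rj_partition := 
  Sub (one_block_set (r * n + j)) one_block_subproof.

Lemma one_blockE :
  (0 < r * n + j)%N -> val one_block = [set [set: 'I_(r * n + j)]].
Proof.
move=> m0; apply/setP => A; rewrite !inE.
case: eqP => [->|] //=; apply/esym/negbTE; rewrite eq_sym.
by rewrite -cards_eq0 cardsT card_ord -lt0n.
Qed.

Fact refines_one_block P : refines P one_block.
Proof.
apply/refinesP => A AP; exists [set: 'I_(r * n + j)]; last exact: subsetT.
have : A != set0 by apply: contraNneq (rj_set0 P) => <-.
move=> /set0Pn[x _]; rewrite !inE eqxx andbT.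
by apply/set0Pn; exists x.
Qed.

HB.instance Definition _ :=
  Order.hasTop.Build refinement_display rj_partition refines_one_block.

End RJPartitions.

(* The poset Pi_m^{r,j} for m = r * n + j, with the minimum \bot adjoined. *)
Definition Pi_poset (r j n : nat) : finTBPOrderType refinement_display :=
  with_bot (rj_partition r j n).

(* Main.v *)
(** Write $p$ for the largest element of the ground set. When $j = 1$ the block
    of $p$ has cardinality congruent to $1$ modulo $r$, so cutting $p$ off
    yields again a partition of the poset; it is the meet of the given
    partition with $a = \{p\} \mid \{p\}^c < \hat1$. So no $x > \hat0$ meets
    $a$ in $\hat0$, and Weisner's argument gives $\mu(\hat0, y) = 0$ for every
    $y \not\le a$. *)
Require Import Defs.
From mathcomp Require Import all_boot all_order all_algebra.
Set Implicit Arguments.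
Unset Strict Implicit.
Unset Printing Implicit Defensive.
Import Order.TTheory GRing.Theory.

Section Weisner.
Local Open Scope order_scope.
Variables (d : Order.disp_t) (T : finPOrderType d).
Implicit Types x y z a : T.

Lemma sum_mobius x y : x < y -> (\sum_(z : T | (x <= z <= y)%O) mobius x z = 0)%R.
Proof.
move=> ltxy; rewrite (bigD1 y) ?lexx ?(ltW ltxy) //= mobius_lt // addrC.
apply/eqP; rewrite subr_eq0; apply/eqP/eq_bigl => z.
by rewrite lt_neqAle -andbA [X in _ && X]andbC.
Qed.

(** Induction on the size of the down-set of [y], with [w] the meet of [y] and [a]. The sum of
    [mobius x0 z] over [x0 <= z <= y] is zero. Its terms with [z <= a] fill the interval from [x0]
    to [w], so they cancel because [x0 < w]; the others vanish by induction, except [z = y]. *)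
Lemma mobius_nle_eq0 x0 a :
    (forall x, x0 < x -> exists2 w, x0 < w &
       forall z, (z <= w) = (z <= x) && (z <= a)) ->
  forall y, x0 < y -> ~~ (y <= a) -> mobius x0 y = 0%R.
Proof.
move=> meet_a y; have [k] := ubnP #|[set z : T | z <= y]|.
elim: k y => // k IH y lek lt0y nleya.
have [w lt0w wE] := meet_a y lt0y.
have := sum_mobius lt0y; rewrite (bigID (fun z => z <= a)) /=.
rewrite (eq_bigl (fun z => (x0 <= z <= w))); last first.
  by move=> z; rewrite wE andbA.
rewrite sum_mobius // add0r (bigD1 y) ?lexx ?(ltW lt0y) //= big1 ?addr0 //.
move=> z /andP[/andP[/andP[le0z lezy] nleza] neqzy].
(* Otherwise [z = x0 < w <= a]. *)
have lt0z : x0 < z.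
  rewrite lt_neqAle le0z andbT; apply: contraNneq nleza => <-.
  by have := ltW lt0w; rewrite wE => /andP[].
apply: IH => //; apply: leq_trans _ (lek : (_ <= k)%N).
apply/proper_card/properP; split.
  by apply/subsetP => t; rewrite !inE => /le_trans; apply.
by exists y; rewrite !inE // lt_geF // lt_neqAle neqzy.
Qed.

End Weisner.

Section Isolate.
Variables r n : nat.
Implicit Types P Q : rj_partition r 1 n.

Fact last_elt_subproof : (r * n < r * n + 1)%N.
Proof. by rewrite addn1. Qed.

Definition last_elt : 'I_(r * n + 1) := Ordinal last_elt_subproof.
Local Notation p := last_elt.

Lemma has_last_elt (B : {set 'I_(r * n + 1)}) :
  [exists i in B, i.+1 == r * n + 1] = (p \in B).
Proof.
apply/exists_inP/idP => [[i iB /eqP iE]|pB]; last by exists p; rewrite //= addn1.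
suff -> : p = i by [].
by apply/val_inj/eqP; rewrite /= -eqSS iE addn1.
Qed.

(** For the block of [p], count the ground set: after cancelling [p], [r * n] is [#|B :\ p|] plus
    the sizes of the other blocks, all multiples of [r]. *)
Lemma dvdn_card_block P B : B \in val P -> r %| #|B :\ p|.
Proof.
case: P => P /= /andP[partP /forall_inP cardP] BP.
have cardC C : C \in P -> p \notin C -> r %| #|C|.
  by move=> CP /negbTE pC; have := cardP C CP; rewrite has_last_elt pC.
have [pB|pB] := boolP (p \in B); last first.
  suff -> : B :\ p = B by exact: cardC.
  by apply/setDidPl; rewrite disjoint_sym disjoints1.
have := card_partition partP; rewrite cardsT card_ord (bigD1 B) //= (cardsD1 p B) pB.
rewrite -addnA [RHS]addnC => /addIn E.
have : r %| #|B :\ p| + \sum_(i in P | i != B) #|i| by rewrite -E dvdn_mulr.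
rewrite dvdn_addl //; apply: dvdn_sum => C /andP[CP neCB].
apply: cardC => //; apply: contraNN neCB => pC.
case/and3P: partP => _ tI _.
by rewrite -(def_pblock tI CP pC) (def_pblock tI BP pB).
Qed.

(** Removing [set0] matters when [[set p]] is already a block of [P], since [B :\ p] is then
    empty. *)
Definition isolate_set P : {set {set 'I_(r * n + 1)}} :=
  ([set p] |: [set B :\ p | B in val P]) :\ set0.

Lemma isolate_setP P A :
  reflect (A = [set p] \/ A != set0 /\ exists2 B, B \in val P & A = B :\ p)
          (A \in isolate_set P).
Proof.
rewrite in_setD1 in_setU1; apply: (iffP andP) => [[A0 /orP[/eqP->|/imsetP[B BP AE]]]|].
- by left.
- by right; split; last by exists B.
case=> [->|[A0 [B BP AE]]].
  by rewrite eqxx; split=> //; apply/set0Pn; exists p; rewrite inE.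
by rewrite A0; split=> //; apply/orP; right; apply/imsetP; exists B.
Qed.

Lemma rj_cover P x : exists2 B, B \in val P & x \in B.
Proof.
case: P => P /= /andP[/and3P[/eqP covP _ _] _].
by have /bigcupP[B] : x \in cover P; [rewrite covP inE | exists B].
Qed.

Fact isolate_subproof P : is_rj_partition r 1 (isolate_set P).
Proof.
apply/andP; split; last first.
  apply/forall_inP => A; rewrite has_last_elt => /isolate_setP[->|].
    by rewrite inE eqxx cards1.
  by move=> [_ [B BP ->]]; rewrite !inE eqxx /= (dvdn_card_block BP).
apply/and3P; split; last by rewrite !inE eqxx.
  rewrite eqEsubset subsetT; apply/subsetP => x _; apply/bigcupP.
  have [->|nxp] := eqVneq x p.
    by exists [set p]; rewrite ?set11 //; apply/isolate_setP; left.
  have [B BP xB] := rj_cover P x.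
  have xBp : x \in B :\ p by rewrite !inE nxp.
  exists (B :\ p) => //; apply/isolate_setP; right; split; last by exists B.
  by apply/set0Pn; exists x.
have disj_p (B : {set 'I_(r * n + 1)}) : [disjoint [set p] & B :\ p].
  by rewrite disjoints1 !inE eqxx.
apply/trivIsetP => A B /isolate_setP[->|[_ [A' AP ->]]] /isolate_setP[->|[_ [B' BP ->]]].
- by rewrite eqxx.
- by rewrite disj_p.
- by rewrite disjoint_sym disj_p.
move=> neAB; have neA'B' : A' != B' by apply: contraNneq neAB => ->.
have /trivIsetP/(_ _ _ AP BP neA'B') := rj_trivIset P.
by apply: disjointW; exact: subsetDl.
Qed.

Definition isolate P : rj_partition r 1 n := Sub (isolate_set P) (isolate_subproof P).

(** The second condition does not mention [P]. It therefore also describes refinement of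
    [isolate (one_block r 1 n)], so [isolate P] is the meet of [P] with that element. *)
Lemma refines_isolate Q P :
  refines Q (isolate P) =
  refines Q P && [forall A in val Q, (p \in A) ==> (A == [set p])].
Proof.
have ne0 A : A \in val Q -> A != set0.
  by move=> AQ; apply: contraNneq (rj_set0 Q) => <-.
apply/refinesP/andP => [QiP|[/refinesP QP /forall_inP Qp] A AQ].
  split; [apply/refinesP|apply/forall_inP] => A AQ;
    have [C /isolate_setP[->|[_ [B BP ->]]] AC] := QiP A AQ.
  - by have [B BP pB] := rj_cover P p; exists B; rewrite ?(subset_trans AC) ?sub1set.
  - by exists B => //; apply: subset_trans AC _; exact: subsetDl.
  - by apply/implyP => pA; rewrite eqEsubset AC sub1set.
  - by apply/implyP => /(subsetP AC); rewrite !inE eqxx.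
have [pA|pA] := boolP (p \in A).
  exists [set p]; first by apply/isolate_setP; left.
  by have := implyP (Qp A AQ) pA => /eqP->.
have [B BP AB] := QP A AQ.
have ABp : A \subset B :\ p by rewrite subsetD1 AB.
exists (B :\ p) => //; apply/isolate_setP; right; split; last by exists B.
(* [B :\ p] contains the nonempty block [A], so it was not discarded. *)
by apply: contraNneq (ne0 A AQ) => E; rewrite -subset0 -E.
Qed.

Lemma one_block_nle_isolate P :
  0 < r -> 0 < n -> ~~ refines (one_block r 1 n) (isolate P).
Proof.
move=> r0 n0; rewrite refines_isolate negb_and; apply/orP; right.
have topE : val (one_block r 1 n) = [set [set: _]] by rewrite one_blockE ?addn1.
apply/forall_inPn; exists [set: 'I_(r * n + 1)]; first by rewrite topE set11.
(* Comparing cardinalities, [r * n + 1 = 1] contradicts the positivity of [r] and [n]. *)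
rewrite in_setT; apply/eqP => /(congr1 (fun A => #|pred_of_set A|)).
rewrite cardsT card_ord cards1 -[RHS]add0n => /addIn/eqP.
by rewrite muln_eq0 !eqn0Ngt r0 n0.
Qed.

End Isolate.

Theorem theorem5p5 (r n : nat) (hr : (0 < r)%N) (hn : (0 < n)%N) :
  mobius (\bot : Pi_poset r 1 n)%O (\top : Pi_poset r 1 n)%O = 0%R.
Proof.
apply: (@mobius_nle_eq0 _ (Pi_poset r 1 n) _ (Some (isolate (one_block r 1 n)))) => //.
(* Any [Some] lies strictly above the adjoined minimum [None], so only the meet formula for [Some Q]
   remains. *)
- case=> [P|//] _; exists (Some (isolate P)) => // -[Q|//].
  change (refines Q (isolate P) = refines Q P && refines Q (isolate (one_block r 1 n))).
  by rewrite !refines_isolate refines_one_block.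
exact: one_block_nle_isolate.
Qed.
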